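(* Fix $n\ge1$. For $k\ge 0$ let $s_k$ be the number of $k\times k$ symmetric zero-one matrices with exactly $n$ ones, and let $S_{11}(n)$ be the number of symmetric square zero-one matrices (of any size) with exactly $n$ ones and no zero row or zero column. Define $\psi_k=s_k2^{-k-1}/S_{11}(n)$, a probability distribution on the nonnegative integers. Consider the random procedure: (i) draw an integer $K$ with distribution $\psi_k$; (ii) choose a $K\times K$ symmetric zero-one matrix with exactly $n$ ones uniformly at random; (iii) delete all rows and all columns all of whose entries are zero. Then the output is uniformly distributed over the symmetric zero-one matrices with exactly $n$ ones and no zero row or column, each being produced with probability $1/S_{11}(n)$.
   Context: Matrices are counted as arrays: the order of rows and columns matters and repeated rows or columns are allowed. The fact that $\psi_k$ sums to $1$ is part of the setting (it follows from $S_{11}(n)=\sum_{k\ge0}s_k2^{-k-1}$). *)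

(* Defs.v *)
From HB Require Import structures.
From mathcomp Require Import all_boot all_order all_algebra finmap.
From mathcomp Require Import all_classical all_reals all_analysis.

Set Implicit Arguments.
Unset Strict Implicit.
Unset Printing Implicit Defensive.

Import Order.TTheory GRing.Theory Num.Theory.

Local Open Scope classical_set_scope.
Local Open Scope ring_scope.

(* Zero-one matrices are matrices over bool, an entry being one when true. *)

Definition ones (p q : nat) (M : 'M[bool]_(p, q)) : nat :=
  #|[pred ij : 'I_p * 'I_q | M ij.1 ij.2]|.

Definition zero_row (p q : nat) (M : 'M[bool]_(p, q)) (i : 'I_p) : bool :=
  [forall j, ~~ M i j].

Definition zero_col (p q : nat) (M : 'M[bool]_(p, q)) (j : 'I_q) : bool :=
  [forall i, ~~ M i j].

Definition symmx (n k : nat) : {set 'M[bool]_k} :=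
  [set M : 'M[bool]_k | (M^T == M) && (ones M == n)]%SET.

Definition s (n k : nat) : nat := #|symmx n k|.

(* Zero-one matrices of arbitrary shape, so that matrices of different sizes
   can be compared. *)
Definition array : Type := {pq : nat * nat & 'M[bool]_(pq.1, pq.2)}.

HB.instance Definition _ := Choice.on array.

Definition arr (p q : nat) (M : 'M[bool]_(p, q)) : array :=
  existT (fun pq : nat * nat => 'M[bool]_(pq.1, pq.2)) (p, q) M.

Definition reduced (n : nat) : set array :=
  [set B | exists (k : nat) (A : 'M[bool]_k),
     [/\ B = arr A, A \in symmx n k,
         forall i, ~~ zero_row A i & forall j, ~~ zero_col A j]].

Lemma finite_reduced (n : nat) : finite_set (reduced n).
Proof.
apply: (@sub_finite_set _ _
  (\bigcup_(k in `I_n.+1) [set arr A | A in [set: 'M[bool]_k]])); last first.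
  apply: bigcup_finite; first exact: finite_II.
  by move=> k _; apply: finite_image; exact: finite_finset.
move=> B [k [A [-> Asym Arow _]]]; exists k; last by exists A.
rewrite /= ltnS; move: Asym; rewrite inE => /andP[_ /eqP <-].
have ex i : exists j, A i j.
  by move: (Arow i); rewrite negb_forall => /existsP[j]; rewrite negbK; exists j.
pose f i : 'I_k * 'I_k := (i, xchoose (ex i)).
have finj : injective f by move=> i j [].
rewrite -[leqLHS]card_ord -(fintype.card_image finj) /ones.
apply: fintype.subset_leq_card; apply/fintype.subsetP => ij.
case/fintype.imageP=> i _ ->.
by rewrite inE /=; exact: xchooseP.
Qed.

(* fset_set is the empty set on infinite sets; this case is excluded by
   finite_reduced. *)
Definition S11 (n : nat) : nat := #|` fset_set (reduced n)|%fset.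

Definition psi (R : realType) (n k : nat) : R :=
  (s n k)%:R * 2^-1 ^+ k.+1 / (S11 n)%:R.

(* enum_val lists the remaining indices in increasing order. *)
Definition delete_zeros (p q : nat) (M : 'M[bool]_(p, q)) : array :=
  arr (\matrix_(i < #|[pred i | ~~ zero_row M i]|,
                j < #|[pred j | ~~ zero_col M j]|)
         M (enum_val i) (enum_val j)).

(* K is drawn with distribution psi and, conditionally on
   K = k, the matrix X is uniform on symmx n k. Equality with arr M, for M of
   size k, includes the event K = k. *)
Record random_symmx (R : realType) (n : nat) (d : measure_display)
    (Omega : measurableType d) (P : probability Omega R)
    (K : Omega -> nat) (X : forall w, 'M[bool]_(K w)) : Prop := RandomSymmx {
  measurable_size : forall k, measurable [set w | K w = k];
  measurable_entries : forall k (M : 'M[bool]_k),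
    measurable [set w | arr (X w) = arr M];
  size_law : forall k, P [set w | K w = k] = (psi R n k)%:E;
  conditional_law : forall k (M : 'M[bool]_k), M \in symmx n k ->
    P [set w | arr (X w) = arr M] =
    (P [set w | K w = k] * ((s n k)%:R^-1)%:E)%E }.

(* Main.v *)
(** A symmetric k x k matrix M that [delete_zeros] sends to a given reduced
    m x m matrix A is determined by the set of its nonzero rows, which can be
    any m-subset of the k indices. Hence A has 'C(k, m) preimages of size k,
    and each of them is drawn with probability 2^-(k+1) / S11(n). The result
    follows from the identity \sum_k 'C(k, m) 2^-(k+1) = 1, valid for every m;
    summed over all A it also shows that psi has total mass 1. *)

Require Import Defs.
From HB Require Import structures.
From mathcomp Require Import all_boot all_order all_algebra finmap.
From mathcomp Require Import all_classical all_reals all_analysis.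
From mathcomp Require Import ring lra.

Set Implicit Arguments.
Unset Strict Implicit.
Unset Printing Implicit Defensive.

Import Order.TTheory GRing.Theory Num.Theory. 
Import numFieldNormedType.Exports.

Local Open Scope classical_set_scope.
Local Open Scope ring_scope.

(** * The binomial series with ratio one half *)

Lemma sum_binS (N m : nat) :
  (\sum_(j < m.+1) 'C(N.+1, j) + 'C(N, m) = 2 * \sum_(j < m.+1) 'C(N, j))%N.
Proof.
elim: m => [|m IHm]; first by rewrite !big_ord1 !bin0.
by rewrite big_ord_recr [in RHS]big_ord_recr /= binS mulnDr -IHm mul2n -addnn
  [('C(N, m.+1) + _)%N]addnC !addnA.
Qed.

(** In fair coin tossing the [k]-th term is the probability that head number [m.+1] comes at toss
    [k.+1]. The subtracted remainder is the probability of at most [m] heads in [N] tosses. The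
    induction uses the summed Pascal rule [sum_binS]. *)
Lemma series_binE (R : realType) (m N : nat) :
  series (fun k => 'C(k, m)%:R * 2^-1 ^+ k.+1 : R) N =
  1 - 2^-1 ^+ N * (\sum_(j < m.+1) 'C(N, j))%N%:R.
Proof.
elim: N => [|N IHN].
  rewrite /series /= big_geq // big_ord_recl bin0 big1 ?addn0; last first.
    by move=> j _; rewrite bin0n.
  by rewrite expr0 mulr1 subrr.
rewrite seriesSr IHN exprS /=.
have /(congr1 (fun x : nat => x%:R : R)) := sum_binS N m.
rewrite natrD natrM => e.
set x := _ ^+ N.
set b := ((\sum_(j < m.+1) 'C(N.+1, j))%N%:R : R) in e |- *.
set c := ((\sum_(j < m.+1) 'C(N, j))%N%:R : R) in e |- *.
have -> : b = 2 * c - 'C(N, m)%:R by lra.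
by field.
Qed.

(* The partial sums increase and are at most 1, so the terms for every m tend
   to 0; this makes the remainder in series_binE tend to 0. *)
Lemma cvg_bin_half (R : realType) (m : nat) :
  ('C(k, m)%:R * 2^-1 ^+ k.+1 : R) @[k --> \oo] --> (0 : R).
Proof.
apply: cvg_series_cvg_0; apply: nondecreasing_is_cvgn.
  by apply: nondecreasing_series => k _ _; rewrite mulr_ge0 // exprn_ge0.
exists 1 => _ [N _ <-]; rewrite series_binE gerBl.
by rewrite mulr_ge0 // exprn_ge0.
Qed.

Lemma cvg_series_bin (R : realType) (m : nat) :
  series (fun k => 'C(k, m)%:R * 2^-1 ^+ k.+1 : R) @ \oo --> (1 : R).
Proof.
(* The remainder becomes a finite sum of terms of the series themselves; the factor 2 offsets the
   exponent [N.+1] in place of [N]. *)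
rewrite (_ : series _ =
    (fun N => 1 - 2 * \sum_(j < m.+1) ('C(N, j)%:R * 2^-1 ^+ N.+1))); last first.
  apply/funext => N; rewrite series_binE natr_sum -mulr_suml exprS.
  by congr (1 - _); field.
rewrite -[X in _ --> X]subr0 -[X in 1 - X](mulr0 2).
apply: cvgB; first exact: cvg_cst.
apply: cvgM; first exact: cvg_cst.
rewrite -[X in _ --> X](_ : \sum_(j < m.+1) 0 = 0); last by rewrite big1.
by apply: cvg_big => [|j _]; [exact: add_continuous|exact: cvg_bin_half].
Qed.

Lemma eseries_bin (R : realType) (m : nat) :
  (\sum_(0 <= k <oo) ('C(k, m)%:R * 2^-1 ^+ k.+1 : R)%:E = 1)%E.
Proof.
apply/cvg_lim => //.
under eq_fun do rewrite sumEFin.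
by apply: cvg_EFin; [exact: nearW|exact: cvg_series_bin].
Qed.

(** * Equality of arrays of different shapes *)

Lemma arrP (p q p' q' : nat) (M : 'M[bool]_(p, q)) (N : 'M[bool]_(p', q')) :
  arr M = arr N <->
  [/\ p = p', q = q' &
      forall i i' j j', val i = val i' -> val j = val j' -> M i j = N i' j'].
Proof.
split=> [|[ep eq_]]; last first.
  subst p' q' => MN; congr arr; apply/matrixP => i j; exact: MN.
(* For variables [B] and [B'] the equality can be eliminated directly, which avoids transporting
   matrices along equalities of sizes. *)
have obs (B B' : array) : B = B' ->
    [/\ (projT1 B).1 = (projT1 B').1, (projT1 B).2 = (projT1 B').2 &
     forall i i' j j', val i = val i' -> val j = val j' ->
       projT2 B i j = projT2 B' i' j'].
  by move=> <-; split=> // i i' j j' /val_inj -> /val_inj ->.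
exact: obs.
Qed.

Lemma arr_inj (p q : nat) : injective (@arr p q).
Proof. by move=> M N /arrP[_ _ MN]; apply/matrixP => i j; exact: MN. Qed.

(** * Principal submatrices and their inverse operation, padding by zeros *)

Section PrincipalSubmatrix.
Variables (k : nat) (S : {set 'I_k}).

Definition principal (M : 'M[bool]_k) : 'M[bool]_#|S| :=
  \matrix_(a, b) M (enum_val a) (enum_val b).

Definition supported (M : 'M[bool]_k) : Prop :=
  forall i j, M i j -> (i \in S) && (j \in S).

(** Padding by zeros outside [S]. The existentials replace an inverse of [enum_val], which is only
    defined on [S]. *)
Definition inflate (A : 'M[bool]_#|S|) : 'M[bool]_k :=
  \matrix_(i, j) [exists a, exists b,
    [&& enum_val a == i, enum_val b == j & A a b]].

Lemma enum_valP_in (i : 'I_k) : i \in S -> exists a : 'I_#|S|, enum_val a = i.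
Proof. by move=> iS; exists (enum_rank_in iS i); rewrite enum_rankK_in. Qed.

Lemma principal_inj (M N : 'M[bool]_k) :
  supported M -> supported N -> principal M = principal N -> M = N.
Proof.
move=> suppM suppN /matrixP MN; apply/matrixP => i j.
have [/andP[iS jS]|out] := boolP ((i \in S) && (j \in S)).
  have [a <-] := enum_valP_in iS; have [b <-] := enum_valP_in jS.
  by have := MN a b; rewrite !mxE.
by rewrite (contraNF (suppM i j)) // (contraNF (suppN i j)).
Qed.

Lemma ones_principal (M : 'M[bool]_k) :
  supported M -> ones (principal M) = ones M.
Proof.
move=> suppM; rewrite /ones.
pose f (ab : 'I_#|S| * 'I_#|S|) : 'I_k * 'I_k :=
  (enum_val ab.1, enum_val ab.2).
have f_inj : injective f.
  by move=> [a b] [a' b'] [/enum_val_inj -> /enum_val_inj ->].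
rewrite -(fintype.card_image f_inj); apply: fintype.eq_card => -[i j].
rewrite !inE /=; apply/fintype.imageP/idP => [[[a b]]|Mij].
  by rewrite !inE mxE => + [-> ->].
have /andP[iS jS] := suppM _ _ Mij.
have [a ea] := enum_valP_in iS; have [b eb] := enum_valP_in jS.
by exists (a, b); rewrite ?inE ?mxE /f /= ?ea ?eb.
Qed.

Lemma trmx_principal (M : 'M[bool]_k) : M^T = M -> (principal M)^T = principal M.
Proof.
move=> /matrixP sym; apply/matrixP => a b; rewrite !mxE.
by rewrite -[LHS]sym mxE.
Qed.

Lemma supported_inflate (A : 'M[bool]_#|S|) : supported (inflate A).
Proof.
move=> i j; rewrite mxE => /existsP[a /existsP[b /and3P[/eqP <- /eqP <- _]]].
by rewrite !enum_valP.
Qed.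

Lemma inflateK (A : 'M[bool]_#|S|) : principal (inflate A) = A.
Proof.
apply/matrixP => a b; rewrite !mxE; apply/existsP/idP => [[a' /existsP[b']]|Aab].
  by move=> /and3P[/eqP/enum_val_inj <- /eqP/enum_val_inj <-].
by exists a; apply/existsP; exists b; rewrite !eqxx.
Qed.

(** Both sides are supported on [S], so it is enough to compare their principal submatrices, which
    are [A^T] and [A]. *)
Lemma trmx_inflate (A : 'M[bool]_#|S|) : A^T = A -> (inflate A)^T = inflate A.
Proof.
move=> sym; apply: principal_inj; rewrite ?inflateK.
- by move=> i j; rewrite mxE => /supported_inflate; rewrite andbC.
- exact: supported_inflate.
apply/matrixP => a b; rewrite -[in RHS]sym -[in RHS](inflateK A).
by rewrite !mxE.
Qed.

End PrincipalSubmatrix.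

(** * Deletion of zero rows and columns, and its fibres *)

Definition nzrows (k : nat) (M : 'M[bool]_k) : {set 'I_k} :=
  [set i | ~~ zero_row M i]%SET.

Lemma zero_col_sym (k : nat) (M : 'M[bool]_k) :
  M^T = M -> zero_col M =1 zero_row M.
Proof.
by move=> sym j; apply: eq_forallb => i; rewrite -[in LHS]sym mxE.
Qed.

Lemma supported_nzrows (k : nat) (M : 'M[bool]_k) :
  M^T = M -> supported (nzrows M) M.
Proof.
move=> sym i j Mij; rewrite !inE !negb_forall; apply/andP; split.
  by apply/existsP; exists j; rewrite Mij.
by apply/existsP; exists i; rewrite -sym mxE Mij.
Qed.

Lemma nzrows_inflate (k : nat) (S : {set 'I_k}) (A : 'M[bool]_#|S|) :
  (forall a, ~~ zero_row A a) -> nzrows (inflate A) = S.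
Proof.
move=> nzA; apply/setP => i; rewrite inE negb_forall.
apply/existsP/idP => [[j]|iS].
  by rewrite negbK => /supported_inflate /andP[].
have [a <-] := enum_valP_in iS.
have := nzA a; rewrite negb_forall => /existsP[b]; rewrite negbK => Aab.
exists (enum_val b); rewrite negbK.
by have /matrixP/(_ a b) := inflateK A; rewrite mxE => ->.
Qed.

(** By symmetry the zero columns have the same indices as the zero rows, so deletion keeps a
    principal submatrix. *)
Lemma delete_zerosE (k : nat) (M : 'M[bool]_k) :
  M^T = M -> delete_zeros M = arr (principal (nzrows M) M).
Proof.
move=> sym; have er : [pred i | ~~ zero_row M i] =i nzrows M.
  by move=> i; rewrite !inE.
have ec : [pred j | ~~ zero_col M j] =i nzrows M.
  by move=> j; rewrite !inE zero_col_sym.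
apply/arrP; split; rewrite ?(fintype.eq_card er) ?(fintype.eq_card ec) //.
move=> i i' j j' /= ei ej; rewrite !mxE.
(* As entries of enumerated lists, the kept indices can be compared although the predicates listing
   them are only extensionally equal. *)
rewrite [enum_val i](enum_val_nth (enum_val i'))
  [enum_val j](enum_val_nth (enum_val j')).
by rewrite (eq_enum er) (eq_enum ec) ei ej -!enum_val_nth.
Qed.

(** A one in a surviving row lies in a column that also survives, so deletion loses no ones and
    creates no new zero row. *)
Lemma reduced_delete_zeros (n k : nat) (M : 'M[bool]_k) :
  M \in symmx n k -> reduced n (delete_zeros M).
Proof.
rewrite inE => /andP[/eqP sym /eqP onesM].
have nz a : ~~ zero_row (principal (nzrows M) M) a.
  have := enum_valP a; rewrite inE negb_forall => /existsP[j]; rewrite negbK.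
  move=> Maj; have /andP[_ /enum_valP_in[b eb]] := supported_nzrows sym Maj.
  by rewrite negb_forall; apply/existsP; exists b; rewrite mxE eb Maj.
have symA := trmx_principal (nzrows M) sym.
exists #|nzrows M|, (principal (nzrows M) M); split=> //.
- exact: delete_zerosE.
- by rewrite inE symA eqxx ones_principal ?onesM ?eqxx //; exact: supported_nzrows.
- by move=> j; rewrite zero_col_sym.
Qed.

(* A matrix in the fibre is determined by the set of its nonzero rows, and
   this set can be any m-subset. *)
Lemma card_delete_zeros_fiber (n k m : nat) (A : 'M[bool]_m) :
  A \in symmx n m -> (forall i, ~~ zero_row A i) ->
  #|[set M in symmx n k | delete_zeros M == arr A]%SET| = 'C(k, m).
Proof.
rewrite inE => /andP[/eqP symA /eqP onesA] nzA.
transitivity 'C(#|'I_k|, m); last by rewrite card_ord.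
rewrite -card_draws.
rewrite -(@card_in_imset _ _ (@nzrows k)); last first.
  move=> M N; rewrite !inE => /andP[/andP[/eqP symM _] /eqP dM].
  move=> /andP[/andP[/eqP symN _] /eqP dN] eMN.
  have suppN : supported (nzrows M) N by rewrite eMN; exact: supported_nzrows.
  apply: (principal_inj (supported_nzrows symM) suppN); apply: arr_inj.
  by rewrite -delete_zerosE // dM eMN -delete_zerosE.
apply: fintype.eq_card => S; rewrite [RHS]inE; apply/imsetP/eqP => [[M]|cS].
  rewrite inE => /andP[]; rewrite inE => /andP[/eqP symM _] + ->.
  by rewrite delete_zerosE // => /eqP /arrP[].
move: A symA onesA nzA; rewrite -{}cS => A symA onesA nzA.
have symM := trmx_inflate symA.
exists (inflate A); last by rewrite nzrows_inflate.
rewrite !inE symM eqxx -(ones_principal (@supported_inflate _ _ A)) inflateK onesA.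
by rewrite eqxx delete_zerosE // nzrows_inflate // inflateK eqxx.
Qed.

(** Double counting: each matrix of [symmx n k] reduces to exactly one [B], and the fibre over [B]
    has binomial size. *)
Lemma sE (n k : nat) :
  s n k = (\sum_(B <- fset_set (reduced n)) 'C(k, (projT1 B).1))%N.
Proof.
transitivity (\sum_(M in symmx n k)
    \sum_(B <- fset_set (reduced n)) (delete_zeros M == B : nat))%N.
  rewrite /s -sum1_card; apply: eq_bigr => M Msym.
  have dM : delete_zeros M \in fset_set (reduced n).
    rewrite in_fset_set ?inE; [exact: reduced_delete_zeros|exact: finite_reduced].
  rewrite (big_rem _ dM) /= eqxx big_seq big1 // => B.
  by rewrite mem_rem_uniq ?fset_uniq // inE eq_sym => /andP[/negbTE ->].
rewrite exchange_big /= big_seq [RHS]big_seq; apply: eq_bigr => B.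
rewrite in_fset_set ?inE; last exact: finite_reduced.
move=> [m [A [-> Asym nzA _]]] /=.
rewrite -(card_delete_zeros_fiber _ Asym nzA) -sum1_card.
rewrite big_mkcond [RHS]big_mkcond /=; apply: eq_bigr => M _.
by rewrite !inE; case: (_ && _) => //=; case: eqP.
Qed.

(** The identity matrix of size [n] is reduced. This justifies dividing by [S11 n]. *)
Lemma S11_gt0 (n : nat) : (0 < S11 n)%N.
Proof.
rewrite cardfs_gt0; apply/fset0Pn.
pose A : 'M[bool]_n := \matrix_(i, j) (i == j).
have symA : A^T = A by apply/matrixP => i j; rewrite !mxE eq_sym.
have nzA i : ~~ zero_row A i.
  by rewrite negb_forall; apply/existsP; exists i; rewrite mxE eqxx.
exists (arr A); rewrite in_fset_set ?inE; last exact: finite_reduced.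
exists n, A; split=> //; last by move=> j; rewrite zero_col_sym.
rewrite inE symA eqxx /ones -[X in _ == X]card_ord /=.
have diag_inj : injective (fun i : 'I_n => (i, i)) by move=> i j [].
rewrite -(fintype.card_image diag_inj); apply/eqP/fintype.eq_card => -[i j].
rewrite !inE mxE /=; apply/eqP/fintype.imageP => [->|[l _ [-> ->]]] //.
by exists j.
Qed.

(** * The law of the random symmetric matrix *)

Section Law.
Variables (R : realType) (n : nat) (d : measure_display).
Variables (Omega : measurableType d) (P : probability Omega R).
Variables (K : Omega -> nat) (X : forall w : Omega, 'M[bool]_(K w)).
Hypothesis X_law : random_symmx n P X.

(** The event that the drawn matrix has size [k] and satisfies [Q], as a finite disjoint union of
    events whose measurability is part of [random_symmx]. *)
Let hit (k : nat) (Q : pred 'M[bool]_k) : set Omega :=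
  \bigcup_(M in [set` Q]) [set w | arr (X w) = arr M].

Let hitP (k : nat) (Q : pred 'M[bool]_k) (w : Omega) :
  hit Q w <-> exists2 M, Q M & arr (X w) = arr M.
Proof. by split=> -[M QM e]; exists M. Qed.

Let measurable_hit (k : nat) (Q : pred 'M[bool]_k) : measurable (hit Q).
Proof.
apply: fin_bigcup_measurable; first exact: finite_finset.
by move=> M _; exact: (measurable_entries X_law).
Qed.

Let P_hit (k : nat) (Q : pred 'M[bool]_k) :
  P (hit Q) = (\sum_(M | Q M) P [set w | arr (X w) = arr M])%E.
Proof.
rewrite measure_fin_bigcup.
- rewrite (_ : [set` Q] = [set` enum Q]); last first.
    by apply/seteqP; split=> M /=; rewrite mem_enum.
  by rewrite -fsbig_seq ?enum_uniq // big_enum.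
- exact: finite_finset.
- by move=> M N _ _ [w [/= -> /arr_inj]].
- by move=> M _; exact: (measurable_entries X_law).
Qed.

Let size_hit (k : nat) : [set w | K w = k] = @hit k predT.
Proof.
apply/seteqP; split=> w /=.
  by move=> <-; apply/hitP; exists (X w).
by move=> /hitP[M _ /arrP[]].
Qed.

Let P_hit_symmx (k : nat) (Q : pred 'M[bool]_k) :
  (forall M, Q M -> M \in symmx n k) ->
  P (hit Q) = (#|Q|%:R * (psi R n k / (s n k)%:R))%:E.
Proof.
move=> Qsym; rewrite P_hit.
rewrite (eq_bigr (fun=> (psi R n k / (s n k)%:R)%:E)); last first.
  by move=> M /Qsym Msym; rewrite (conditional_law X_law) // (size_law X_law).
by rewrite sumEFin sumr_const mulr_natl.
Qed.

(* The matrices of symmx n k already carry the whole mass of the event K = k. *)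
Let P_hit_outside (k : nat) (Q : pred 'M[bool]_k) :
  (forall M, Q M -> M \notin symmx n k) -> P (hit Q) = 0%E.
Proof.
move=> Qout; apply/eqP; rewrite -measure_le0.
apply: (@le_trans _ _ (P (hit [pred M | M \notin symmx n k]))).
  apply: le_measure; rewrite ?inE //.
  by move=> w /hitP[M /Qout Mout e]; apply/hitP; exists M.
have total : P (hit (mem (symmx n k))) = (psi R n k)%:E.
  rewrite P_hit_symmx // mulrC -mulrA -/(s n k).
  (* If no matrix of size [k] exists, nothing cancels, but [psi R n k] is then 0 as well. *)
  have [s0|s_neq0] := eqVneq (s n k) 0%N; last by rewrite mulVf ?pnatr_eq0 // mulr1.
  by rewrite /psi s0 !mul0r.
have := size_law X_law k; rewrite size_hit P_hit (bigID (mem (symmx n k))) /=.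
rewrite -P_hit total.
rewrite -(P_hit [pred M | M \notin symmx n k]) /=.
have := fin_num_measure P _ (measurable_hit [pred M | M \notin symmx n k]).
case: (P _) => // r _ [] /eqP.
by rewrite -[X in _ == X]addr0 (inj_eq (addrI _)) => /eqP ->.
Qed.

(** The factor [s n k] in [psi] cancels the uniform weight [1 / s n k], so every matrix of
    [symmx n k] has the same mass, depending only on [k]; the sum runs over the disjoint events of
    fixed size. *)
Lemma random_symmx_law (E : set array) :
  (P [set w | E (arr (X w))] = \sum_(0 <= k <oo)
     (#|[set M in symmx n k | `[< E (arr M) >]]%SET|%:R * 2^-1 ^+ k.+1
      / (S11 n)%:R)%:E)%E.
Proof.
rewrite (_ : [set w | _] =
    \bigcup_k hit [pred M : 'M[bool]_k | `[< E (arr M) >]]); last first.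
  apply/seteqP; split=> w /=.
    by move=> Ew; exists (K w) => //; apply/hitP; exists (X w); rewrite //= asboolT.
  by move=> [k _ /hitP[M /= /asboolP EM ->]].
rewrite measure_bigcup /=; first last.
- by move=> k l _ _ [w [/hitP[M _ /arrP[Kk _ _]] /hitP[N _ /arrP[+ _ _]]]]; rewrite Kk.
- by move=> k _; exact: measurable_hit.
rewrite (@eq_eseriesl _ _ xpredT); last by move=> k; rewrite in_setT.
apply: eq_eseriesr => k _; set Q := [pred M | _].
rewrite P_hit (bigID (mem (symmx n k))) /=.
rewrite -(P_hit [pred M | Q M && (M \in symmx n k)]).
rewrite -(P_hit [pred M | Q M && (M \notin symmx n k)]).
rewrite [X in (_ + X)%E]P_hit_outside ?adde0; last by move=> M /andP[].
rewrite P_hit_symmx; last by move=> M /andP[].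
rewrite (_ : #|[pred M | _]| = #|[set M in symmx n k | Q M]%SET|); last first.
  by apply: fintype.eq_card => M; rewrite !inE andbC.
(* The cancellation requires [s n k] to be nonzero; otherwise both sides count an empty set of
   matrices. *)
have [s0|s_neq0] := eqVneq (s n k) 0%N.
  suff -> : #|[set M in symmx n k | Q M]%SET| = 0%N by rewrite !mul0r.
  apply/eqP; rewrite -leqn0 -s0; apply: subset_leq_card.
  by apply/fintype.subsetP => M; rewrite inE => /andP[].
congr (_%:E); rewrite /psi; field.
by rewrite !pnatr_eq0 s_neq0 -lt0n S11_gt0.
Qed.

End Law.

(** * Total mass of [psi] and uniformity of the output *)

Lemma psi_ge0 (R : realType) (n k : nat) : 0 <= psi R n k.
Proof. by rewrite /psi !mulr_ge0 ?invr_ge0 ?exprn_ge0. Qed.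

(** After expanding [s n k] by [sE] and exchanging the sums, each of the [S11 n] reduced arrays
    contributes a binomial series equal to 1. *)
Lemma eseries_psi (R : realType) (n : nat) :
  (\sum_(0 <= k <oo) (psi R n k)%:E = 1)%E.
Proof.
pose u (m k : nat) : R := 'C(k, m)%:R * 2^-1 ^+ k.+1.
have u_ge0 m k : 0 <= u m k by rewrite mulr_ge0 // exprn_ge0.
rewrite (eq_eseriesr (g := fun k => (((S11 n)%:R^-1)%:E *
    \sum_(B <- fset_set (reduced n)) (u (projT1 B).1 k)%:E)%E)); last first.
  move=> k _; rewrite sumEFin -EFinM /psi sE natr_sum -mulr_suml.
  by congr (_%:E); rewrite [RHS]mulrC.
rewrite nneseriesZl; last by move=> k _; apply: sume_ge0 => B _; rewrite lee_fin.
rewrite nneseries_sum; last by move=> *; rewrite lee_fin.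
under eq_bigr do rewrite eseries_bin.
rewrite sumEFin big_const_seq count_predT iter_addr addr0 -/(S11 n).
by rewrite -EFinM mulVf // pnatr_eq0 -lt0n S11_gt0.
Qed.

Theorem theorem4 (R : realType) (n : nat) (hn : (1 <= n)%N) :
  [/\ forall k : nat, 0 <= psi R n k,
      (\sum_(0 <= k <oo) (psi R n k)%:E = 1)%E &
      forall (d : measure_display) (Omega : measurableType d)
        (P : probability Omega R)
        (K : Omega -> nat) (X : forall w : Omega, 'M[bool]_(K w)),
      random_symmx n P X ->
      P [set w | reduced n (delete_zeros (X w))] = 1%E /\
      forall B : array, reduced n B ->
        P [set w | delete_zeros (X w) = B] = (((S11 n)%:R)^-1)%:E].
Proof.
split=> [k||d Omega P K X X_law]; [exact: psi_ge0|exact: eseries_psi|].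
(* Deletion as a map on arrays turns events about the output into sets of arrays, as
   [random_symmx_law] expects. *)
pose del (B : array) := delete_zeros (projT2 B); split.
  rewrite (random_symmx_law X_law [set B | reduced n (del B)]).
  (* With 1 written as the mass of [psi], the terms agree because every matrix of [symmx n k] has a
     reduced output. *)
  rewrite -[RHS](eseries_psi R n); apply: eq_eseriesr => k _.
  congr (_%:R * _ / _)%:E; apply: fintype.eq_card => M; rewrite inE andb_idr //.
  by move=> Msym; apply/asboolP; exact: reduced_delete_zeros.
move=> B [m [A [-> Asym nzA _]]].
rewrite (random_symmx_law X_law [set B | del B = arr A]).
(* The target is expanded along the binomial series for the size [m] of [A], to be matched term by
   term with the fibre cardinals. *)
rewrite -[RHS]mule1 -[X in (_ * X)%E](eseries_bin R m) -nneseriesZl; last first.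
  by move=> k _; rewrite lee_fin mulr_ge0 // exprn_ge0.
apply: eq_eseriesr => k _; rewrite -EFinM [X in _ = X%:E]mulrC.
congr (_%:R * _ / _)%:E; rewrite -(card_delete_zeros_fiber k Asym nzA).
by apply: fintype.eq_card => M; rewrite !inE; congr andb; apply/asboolP/eqP.
Qed.
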